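(* The robust two-stage combinatorial optimization problem with the two-stage budgeted uncertainty variant $\mathcal{U}^{\rm var}$, $$\min_{x\in\mathcal{X}}\max_{c\in\mathcal{U}^{\rm var}}\min_{y\in\mathcal{X}(x)}\max_{d\in\mathcal{U}^{\rm var}(c)} c^tx+d^ty,$$ can be decomposed into two problems of nominal type.
   Context: Notation: $[n]=\{1,\dots,n\}$ and $\min\emptyset=\infty$. Nominal data: $A\in\mathbb{R}^{m\times n}$, $b\in\mathbb{R}^m$, $\mathcal{X}_{\rm nom}=\{x\in\{0,1\}^n: Ax\ge b\}$ (no integrality assumption on the LP relaxation is made). A problem of nominal type is $\min_{x\in\mathcal{X}_{\rm nom}} v^tx+M$ for a cost vector $v\in\mathbb{R}^n$ and a constant $M$. Put $\mathcal{X}=\{0,1\}^n$ and $\mathcal{X}(x)=\{y\in\{0,1\}^n: A(x+y)\ge b,\ x+y\le\mathbf{1}\}$. Uncertainty variant: given $0\le\underline{c}_i\le\overline{c}_i$, $0\le\underline{d}_i\le\overline{d}_i$ ($i\in[n]$) and $\Gamma\ge0$, $$\mathcal{U}^{\rm var}=\{c\in\mathbb{R}^n_+: c_i=\underline{c}_i+\delta_i,\ \delta_i\in[0,\overline{c}_i-\underline{c}_i]\ \forall i\in[n],\ \textstyle\sum_i\delta_i\le\Gamma\},$$ $$\mathcal{U}^{\rm var}(c)=\{d\in\mathbb{R}^n_+: d_i=\underline{d}_i+\delta_i,\ \delta_i\in[0,\overline{d}_i-\underline{d}_i]\ \forall i\in[n],\ \textstyle\sum_i\delta_i\le\Gamma-\sum_i(c_i-\underline{c}_i)\}.$$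 The variables $\delta_i$ may be either continuous (as displayed) or discrete (restricted to integers); in the discrete case all differences $\overline{c}_i-\underline{c}_i$, $\overline{d}_i-\underline{d}_i$ and the budget $\Gamma$ are integers. ''Can be decomposed into two problems of nominal type'' means: from the data one can directly construct (in polynomial time, without solving the problem) two problems of nominal type over $\mathcal{X}_{\rm nom}$ such that the optimal value of the robust problem is the minimum of their two optimal values. *)

(* Defs.v *)
From mathcomp Require Import all_boot all_order all_algebra.
From mathcomp Require Import all_classical all_reals ereal.

Set Implicit Arguments.
Unset Strict Implicit.
Unset Printing Implicit Defensive.
Import Order.TTheory GRing.Theory Num.Theory.
Local Open Scope classical_set_scope.
Local Open Scope ring_scope.

Section Problems.
Variable R : realType.

Record instance (m n : nat) := Instance {
  lhs : 'M[R]_(m, n);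
  rhs : 'cV[R]_m;
  c_lo : 'cV[R]_n;
  c_hi : 'cV[R]_n;
  d_lo : 'cV[R]_n;
  d_hi : 'cV[R]_n;
  budget : R }.

Definition vle k (u v : 'cV[R]_k) : bool := [forall i, u i 0 <= v i 0].

Definition dot n (u v : 'cV[R]_n) : R := \sum_i u i 0 * v i 0.

Definition realvec n (x : 'cV[bool]_n) : 'cV[R]_n :=
  map_mx (fun e : bool => (e : nat)%:R) x.

Definition integral n (u : 'cV[R]_n) : Prop := forall i, u i 0 \is a Num.int.

Definition valid (discrete : bool) m n (I : instance m n) : Prop :=
  [/\ vle 0 (c_lo I) && vle (c_lo I) (c_hi I),
      vle 0 (d_lo I) && vle (d_lo I) (d_hi I),
      0 <= budget I &
      discrete -> [/\ integral (c_hi I - c_lo I), integral (d_hi I - d_lo I)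
                    & budget I \is a Num.int]].

Definition Xnom m n (A : 'M[R]_(m, n)) (b : 'cV[R]_m) : {set 'cV[bool]_n} :=
  [set x | vle b (A *m realvec x)].

Definition nominal_value m n (A : 'M[R]_(m, n)) (b : 'cV[R]_m)
    (v : 'cV[R]_n) (M : R) : \bar R :=
  \big[mine/+oo%E]_(x in Xnom A b) (dot v (realvec x) + M)%:E.

Definition Xrec m n (A : 'M[R]_(m, n)) (b : 'cV[R]_m) (x : 'cV[bool]_n) :
    {set 'cV[bool]_n} :=
  [set y | vle b (A *m (realvec x + realvec y))
           && vle (realvec x + realvec y) (const_mx 1)].

Definition budgeted (discrete : bool) n (lo hi : 'cV[R]_n) (G : R) :
    set 'cV[R]_n :=
  [set c | vle 0 c /\ exists delta : 'cV[R]_n,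
     [/\ c = lo + delta,
         forall i, 0 <= delta i 0 <= hi i 0 - lo i 0,
         discrete -> integral delta
       & \sum_i delta i 0 <= G]].

Definition Uvar (discrete : bool) m n (I : instance m n) : set 'cV[R]_n :=
  budgeted discrete (c_lo I) (c_hi I) (budget I).

Definition Uvar2 (discrete : bool) m n (I : instance m n) (c : 'cV[R]_n) :
    set 'cV[R]_n :=
  budgeted discrete (d_lo I) (d_hi I)
    (budget I - \sum_i (c i 0 - c_lo I i 0)).

(* The inner maxima are written as suprema in the extended reals, since the
   value of the recourse problem is +oo when Xrec is empty.  For valid data
   they are attained. *)
Definition robust_value (discrete : bool) m n (I : instance m n) : \bar R :=
  \big[mine/+oo%E]_(x : 'cV[bool]_n)
    ereal_sup [set \big[mine/+oo%E]_(y in Xrec (lhs I) (rhs I) x)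
                     ereal_sup [set (dot c (realvec x) + dot d (realvec y))%:E
                               | d in Uvar2 discrete I c]
              | c in Uvar discrete I].

End Problems.

(* "Constructible in polynomial time" is made precise with a random access
   machine that has registers for natural numbers and arrays of real numbers,
   the entries of an array being addressed by two natural number registers.
   The only operations are the successor on natural numbers, addition,
   subtraction and comparison on reals, copying, and the constants 0 and 1,
   each at unit cost.  Without a multiplication, the numbers occurring in the
   first k steps are integer combinations of 1 and the data with coefficients
   at most 2 ^ k in absolute value, so on rational data a polynomial number of
   steps also means polynomial time on a Turing machine. *)

(* Loc a r s addresses the entry of array a whose row and column numbers are
   the current contents of the natural number registers r and s. *)
Inductive loc := Loc of nat & nat & nat.

Inductive nexpr := NZero | NReg of nat | NSucc of nat.

Inductive rexpr := RZero | ROne | RLoc of loc | RAdd of loc & loc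
                 | RSub of loc & loc.

Inductive test := NLt of nat & nat | RLe of loc & loc.

Inductive prog :=
| Skip
| NSet of nat & nexpr
| RSet of loc & rexpr
| Seq of prog & prog
| If of test & prog & prog
| While of test & prog.

Section Semantics.
Variable R : realType.

Record state := State {
  nreg : nat -> nat;
  rarr : nat -> nat -> nat -> R }.

Definition rget (s : state) (l : loc) : R :=
  let: Loc a r q := l in rarr s a (nreg s r) (nreg s q).

Definition neval (s : state) (e : nexpr) : nat :=
  match e with
  | NZero => 0%N
  | NReg r => nreg s r
  | NSucc r => (nreg s r).+1
  end.

Definition reval (s : state) (e : rexpr) : R :=
  match e with
  | RZero => 0
  | ROne => 1
  | RLoc l => rget s l
  | RAdd l1 l2 => rget s l1 + rget s l2
  | RSub l1 l2 => rget s l1 - rget s l2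
  end.

Definition teval (s : state) (t : test) : bool :=
  match t with
  | NLt r q => (nreg s r < nreg s q)%N
  | RLe l1 l2 => rget s l1 <= rget s l2
  end.

Definition nset (s : state) (r k : nat) : state :=
  State (fun q => if q == r then k else nreg s q) (rarr s).

Definition rset (s : state) (l : loc) (z : R) : state :=
  let: Loc a r q := l in
  State (nreg s) (fun a' i j =>
    if [&& a' == a, i == nreg s r & j == nreg s q] then z else rarr s a' i j).

(* run p s s' t: started in s, the program p halts in s' after t steps. *)
Inductive run : prog -> state -> state -> nat -> Prop :=
| run_skip s : run Skip s s 1
| run_nset s r e : run (NSet r e) s (nset s r (neval s e)) 1
| run_rset s l e : run (RSet l e) s (rset s l (reval s e)) 1
| run_seq p q s s1 s2 t1 t2 :
    run p s s1 t1 -> run q s1 s2 t2 -> run (Seq p q) s s2 (t1 + t2)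
| run_if b p q s s' t :
    run (if teval s b then p else q) s s' t -> run (If b p q) s s' t.+1
| run_while_false b p s : ~~ teval s b -> run (While b p) s s 1
| run_while_true b p s s1 s2 t1 t2 : teval s b ->
    run p s s1 t1 -> run (While b p) s1 s2 t2 ->
    run (While b p) s s2 (t1 + t2).+1.

Definition pad m n (A : 'M[R]_(m, n)) (i j : nat) : R :=
  match insub i, insub j with
  | Some i', Some j' => A i' j'
  | _, _ => 0
  end.

Definition input m n (I : instance R m n) : state :=
  State (fun r => nth 0%N [:: m; n] r)
        (fun a => nth (fun _ _ => 0)
           [:: pad (lhs I); pad (rhs I); pad (c_lo I); pad (c_hi I);
               pad (d_lo I); pad (d_hi I); pad ((budget I)%:M : 'M[R]_1)] a).

Definition input_size (m n : nat) : nat := (m * n + m + 4 * n + 1)%N.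

Definition out_vec n (s : state) (a : nat) : 'cV[R]_n := \col_i rarr s a i 0%N.

Definition out_scalar (s : state) (a : nat) : R := rarr s a 0%N 0%N.

End Semantics.

(* The output convention is that arrays 7 and 8 hold the cost vector and the
   constant of the first problem, arrays 9 and 10 those of the second.  A
   problem of nominal type always keeps the constraints of Xnom, and one
   program and one polynomial bound must serve all dimensions and all data.
   Dropping the time bound would make the notion trivial: the cost vectors 0
   and constants equal to the optimal value would do. *)
Definition decomposable_into_two_nominal (R : realType)
    (admissible : forall m n, instance R m n -> Prop)
    (value : forall m n, instance R m n -> \bar R) : Prop :=
  exists (p : prog) (k : nat), forall (m n : nat) (I : instance R m n),
    admissible m n I ->
    exists (s : state R) (t : nat),
      [/\ run p (input I) s t,
          (t <= k * input_size m n ^ k)%N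
        & value m n I =
            mine (nominal_value (lhs I) (rhs I) (out_vec n s 7) (out_scalar s 8))
                 (nominal_value (lhs I) (rhs I) (out_vec n s 9) (out_scalar s 10))].

(* Main.v *)
Require Import Defs.
From mathcomp Require Import all_boot all_order all_algebra.
From mathcomp Require Import all_classical all_reals ereal.
From mathcomp Require Import lra zify.

(** Fix [x] and write [D x = dot (c_hi - c_lo) (realvec x)] and
[D' y = dot (d_hi - d_lo) (realvec y)] for the largest possible increases of
the two costs.  A unit of budget spent in the first stage on a selected item
raises the cost by one whatever the recourse [y] is, whereas a unit kept for
the second stage raises it by at most one, and only if [D' y] leaves room.
Hence the adversary loses nothing by spending [g = min (budget, D x)] at once,
before [y] is known, which leaves [min (budget - g, D' y)] for the second
stage.  The total increase is [min (budget, D x + D' y)], so that the robust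
value is the minimum, over all [x] and all recourses [y] of [x], of the smaller
of
[[
  dot c_lo x + dot d_lo y + budget      and      dot c_hi x + dot d_hi y
]]
([worst_two_stage_cost]).  In this expression no maximum is left, and the
minimum over pairs splits into two deterministic two-stage problems.  In such
a problem each item of [x + y] may be bought in the cheaper of the two stages,
so it is a nominal problem for the entrywise minimum of the two cost vectors
([nominal_two_stage]).  With [budget] and [0] as constants these two nominal
problems are the decomposition ([robust_value_decomposition]).

Discreteness is harmless: an integral budget spent item by item on integral
capacities is spent in integral amounts ([greedy_spending]), so the same worst
case is attained in both settings.

The cost vectors are computed by a single loop over the items with a bounded
number of steps per item ([run_min_loop]). *)

Set Implicit Arguments.
Unset Strict Implicit.
Unset Printing Implicit Defensive.
Import Order.TTheory GRing.Theory Num.Theory.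
Local Open Scope classical_set_scope.
Local Open Scope ring_scope.

(** * Cost vectors and binary vectors *)

Lemma vleP (R : realType) k (u v : 'cV[R]_k) :
  reflect (forall i, u i 0 <= v i 0) (vle u v).
Proof. exact: forallP. Qed.

Lemma dotDl (R : realType) n (u v w : 'cV[R]_n) :
  dot (u + v) w = dot u w + dot v w.
Proof.
by rewrite /dot -big_split; apply: eq_bigr => i _; rewrite mxE mulrDl.
Qed.

Lemma dot_ge0 (R : realType) n (u v : 'cV[R]_n) :
  vle 0 u -> vle 0 v -> 0 <= dot u v.
Proof.
move=> /vleP u0 /vleP v0; apply: sumr_ge0 => i _.
by have := u0 i; have := v0 i; rewrite mxE => *; exact: mulr_ge0.
Qed.

Lemma realvec_ge0 (R : realType) n (z : 'cV[bool]_n) : vle 0 (realvec R z).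
Proof. by apply/vleP => i; rewrite !mxE ler0n. Qed.

(** * Spending a budget *)

(** Serving the items in order, each up to its capacity, uses up the budget or
all of the capacity.  Item [i] receives the increase of [Num.min G (S k)] from
[k = i] to [k = i + 1], where [S] is the sequence of partial sums of the
capacities; so the total telescopes, and integrality is inherited since
[Num.min] only selects one of its arguments. *)
Lemma greedy_spending (R : realType) n (u : 'cV[R]_n) (G : R) :
  0 <= G -> vle 0 u ->
  exists delta : 'cV[R]_n,
    [/\ forall i, 0 <= delta i 0 <= u i 0,
        \sum_i delta i 0 = Num.min G (\sum_i u i 0)
      & integral u -> G \is a Num.int -> integral delta].
Proof.
move=> G0 /vleP u0; pose S k : R := \sum_(j < n | (j < k)%N) u j 0.
have SS (i : 'I_n) : S i.+1 = S i + u i 0.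
  rewrite /S (bigD1 i) //= addrC; congr (_ + _); apply: eq_bigl => j.
  by rewrite ltnS andbC ltn_neqAle.
have S0 : S 0%N = 0 by rewrite /S big1.
have Sn : S n = \sum_i u i 0 by apply: eq_bigl => j; rewrite ltn_ord.
exists (\col_i (Num.min G (S i.+1) - Num.min G (S i))); split.
- move=> i; rewrite mxE SS; have := u0 i; rewrite mxE => ui0.
  case: (leP G (S i + u i 0)) => ?; case: (leP G (S i)) => ?;
    apply/andP; split; lra.
- under eq_bigr do rewrite mxE.
  rewrite -(big_mkord xpredT (fun i => Num.min G (S i.+1) - Num.min G (S i))).
  by rewrite telescope_sumr // Sn S0 (min_idPr G0) subr0.
- move=> iu iG i; rewrite mxE.
  have iS k : Num.min G (S k) \is a Num.int.
    by case: leP => // _; apply: rpred_sum => j _; exact: iu.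
  exact: rpredB.
Qed.

Definition spent (R : realType) n (lo c : 'cV[R]_n) : R :=
  \sum_i (c i 0 - lo i 0).

Lemma spentD (R : realType) n (lo delta : 'cV[R]_n) :
  spent lo (lo + delta) = \sum_i delta i 0.
Proof. by apply: eq_bigr => i _; rewrite mxE addrAC subrr add0r. Qed.

(** An increase of the costs pays off only on the selected items, where it is
limited both by what is spent and by the room that the intervals leave.  The
bound is in terms of what [c] really spends, because in the first stage the
rest remains available to the adversary. *)
Lemma budgeted_dot_le (R : realType) disc n (lo hi : 'cV[R]_n) (G : R)
    (c : 'cV[R]_n) (z : 'cV[bool]_n) :
  budgeted disc lo hi G c ->
  dot c (realvec R z) <= dot lo (realvec R z)
    + Num.min (spent lo c) (dot (hi - lo) (realvec R z)).
Proof.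
case=> _ [delta [-> deltaP _ _]]; rewrite spentD.
rewrite dotDl lerD2l le_min; apply/andP; split.
  apply: ler_sum => i _; have /andP[d0 _] := deltaP i.
  by rewrite mxE; case: (z i 0); rewrite ?mulr1 ?mulr0.
apply: ler_sum => i _; have /andP[_ d1] := deltaP i.
by rewrite ler_wpM2r ?mxE ?ler0n.
Qed.

Lemma spent_bounds (R : realType) (disc : bool) n (lo hi : 'cV[R]_n) (G : R)
    (c : 'cV[R]_n) :
  budgeted disc lo hi G c ->
  [/\ 0 <= spent lo c, spent lo c <= G & disc -> spent lo c \is a Num.int].
Proof.
case=> _ [delta [-> deltaP idelta sG]]; rewrite spentD.
split=> //; first by apply: sumr_ge0 => i _; case/andP: (deltaP i).
by move=> /idelta id; apply: rpred_sum => i _; exact: id.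
Qed.

(** Greedy spending restricted to the items selected by [z] attains the bound
of [budgeted_dot_le] and wastes nothing outside of [z]; the equation for
[spent] is what determines the budget of the second stage. *)
Lemma budgeted_dot_attained (R : realType) (disc : bool) n
    (lo hi : 'cV[R]_n) (G : R) (z : 'cV[bool]_n) :
  vle 0 lo -> vle lo hi -> 0 <= G ->
  (disc -> integral (hi - lo) /\ G \is a Num.int) ->
  exists c : 'cV[R]_n, let g := Num.min G (dot (hi - lo) (realvec R z)) in
  [/\ budgeted disc lo hi G c, spent lo c = g &
      dot c (realvec R z) = dot lo (realvec R z) + g].
Proof.
move=> /vleP lo0 /vleP lohi G0 int.
(* Items outside of [z] get capacity 0. *)
pose u : 'cV[R]_n := \col_i ((hi - lo) i 0 * realvec R z i 0).
have u0 : vle 0 u.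
  apply/vleP => i; rewrite !mxE mulr_ge0 ?ler0n // subr_ge0; exact: lohi.
have [delta [dP dsum dint]] := greedy_spending G0 u0.
have du : \sum_i u i 0 = dot (hi - lo) (realvec R z).
  by apply: eq_bigr => i _; rewrite mxE.
exists (lo + delta) => /=; rewrite -du -dsum; split.
- split.
    apply/vleP => i; have /andP[d0 _] := dP i.
    by have := lo0 i; rewrite !mxE => l0; exact: addr_ge0.
  exists delta; split=> //.
  + move=> i; have := dP i; have := lohi i; rewrite !mxE.
    by case: (z i 0) => /=; rewrite ?mulr1 ?mulr0; lra.
  + move=> /int[ihl iG]; apply: dint => // i; rewrite mxE.
    by rewrite rpredM ?ihl // mxE natr_int.
  + by rewrite dsum ge_min lexx.
- exact: spentD.
- rewrite dotDl; congr (_ + _); apply: eq_bigr => i _.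
  have := dP i; rewrite !mxE; case: (z i 0) => /=; first by rewrite !mulr1.
  by rewrite !mulr0 -eq_le => /eqP <-.
Qed.

Lemma worst_recourse_cost (R : realType) (disc : bool) n
    (lo hi : 'cV[R]_n) (G a : R) (z : 'cV[bool]_n) :
  vle 0 lo -> vle lo hi -> 0 <= G ->
  (disc -> integral (hi - lo) /\ G \is a Num.int) ->
  ereal_sup [set (a + dot d (realvec R z))%:E | d in budgeted disc lo hi G] =
  (a + (dot lo (realvec R z)
        + Num.min G (dot (hi - lo) (realvec R z))))%:E.
Proof.
move=> lo0 lohi G0 int; apply/eqP; rewrite eq_le; apply/andP; split.
  apply: ge_ereal_sup => _ [d dU <-]; rewrite lee_fin lerD2l.
  apply: le_trans (budgeted_dot_le _ dU) _; rewrite lerD2l.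
  by have [_ sG _] := spent_bounds dU; exact: le_min2.
have [d [dU _ dE]] := budgeted_dot_attained z lo0 lohi G0 int.
by apply: ereal_sup_ubound; exists d; rewrite // dE.
Qed.

(** * The worst case for a first-stage decision *)

(** Since the inner minimum is over [y], a maximizing [c] has to be good for
all [y] simultaneously.  The one that spends [Num.min (budget I) (D x)] on the
items of [x] is: spending [g] in the first stage makes the total increase
[g + Num.min (budget I - g) (D' y)], that is [Num.min (budget I) (g + D' y)],
which is nondecreasing in [g] for each [y]. *)
Lemma worst_two_stage_cost (R : realType) (disc : bool) m n
    (I : instance R m n) (x : 'cV[bool]_n) (Y : {set 'cV[bool]_n}) :
  valid disc I ->
  ereal_sup [set \big[mine/+oo%E]_(y in Y)
                   ereal_sup [set (dot c (realvec R x) + dot d (realvec R y))%:E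
                             | d in Uvar2 disc I c]
            | c in Uvar disc I] =
  \big[mine/+oo%E]_(y in Y)
    mine (dot (c_lo I) (realvec R x) + dot (d_lo I) (realvec R y)
          + budget I)%:E
         (dot (c_hi I) (realvec R x) + dot (d_hi I) (realvec R y))%:E.
Proof.
case=> /andP[c0 chl] /andP[d0 dhl] G0 int.
set cx := dot (c_lo I) (realvec R x).
pose w (c : 'cV[R]_n) y : \bar R := (dot c (realvec R x)
  + (dot (d_lo I) (realvec R y)
     + Num.min (budget I - spent (c_lo I) c)
               (dot (d_hi I - d_lo I) (realvec R y))))%:E.
have innerE c : Uvar disc I c ->
    \big[mine/+oo%E]_(y in Y)
      ereal_sup [set (dot c (realvec R x) + dot d (realvec R y))%:E
                | d in Uvar2 disc I c] = \big[mine/+oo%E]_(y in Y) w c y.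
  move=> cU; have [_ sG sint] := spent_bounds cU.
  apply: eq_bigr => y _; apply: worst_recourse_cost => //.
    by rewrite subr_ge0.
  by move=> D; have [_ idd iG] := int D; split=> //; apply: rpredB (sint D).
have hiE lo hi (z : 'cV[R]_n) : dot hi z = dot lo z + dot (hi - lo) z.
  by rewrite -dotDl addrC subrK.
apply/eqP; rewrite eq_le; apply/andP; split.
  (* No [c] does better, already for each [y] separately. *)
  apply: ge_ereal_sup => _ [c cU <-]; rewrite innerE //.
  apply: le_bigmin2 => y _; rewrite -EFin_min lee_fin.
  have := budgeted_dot_le x cU; rewrite (hiE (c_lo I) (c_hi I)).
  rewrite (hiE (d_lo I) (d_hi I)) -/cx.
  case: (leP (spent (c_lo I) c)) => ?; case: (leP (budget I - _)) => ? ?;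
    by rewrite le_min; apply/andP; split; lra.
(* One [c] attains the bounds of all [y] together. *)
have int1 : disc -> integral (c_hi I - c_lo I) /\ budget I \is a Num.int.
  by move=> /int[].
have [c [cU sE cE]] := budgeted_dot_attained x c0 chl G0 int1.
apply: le_trans (ereal_sup_ubound _); last by exists c.
rewrite innerE //; apply: le_bigmin2 => y _; rewrite -EFin_min lee_fin.
have q0 : 0 <= dot (d_hi I - d_lo I) (realvec R y).
  apply: dot_ge0 (realvec_ge0 _ _); apply/vleP => i.
  by move/vleP/(_ i): dhl; rewrite !mxE subr_ge0.
rewrite cE sE (hiE (c_lo I) (c_hi I)) (hiE (d_lo I) (d_hi I)) -/cx.
by rewrite ge_min; case: (leP (budget I)) => ?; case: (leP (budget I - _)) => ?;
  apply/orP; lra.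
Qed.

(** * Deterministic two-stage problems *)

Definition vmin (R : realType) n (u v : 'cV[R]_n) : 'cV[R]_n :=
  \col_i Num.min (u i 0) (v i 0).

(** A pair [(x, y)] with [y] a recourse of [x] is a splitting of the feasible
vector [z = x + y] into disjoint parts, and every splitting of a feasible [z]
occurs.  The cheapest one puts item [i] of [z] into [x] exactly when
[p i 0 <= q i 0]. *)
Lemma nominal_two_stage (R : realType) m n (A : 'M[R]_(m, n)) (b : 'cV[R]_m)
    (p q : 'cV[R]_n) (M : R) :
  \big[mine/+oo%E]_(x : 'cV[bool]_n) \big[mine/+oo%E]_(y in Xrec A b x)
     (dot p (realvec R x) + dot q (realvec R y) + M)%:E =
  nominal_value A b (vmin p q) M.
Proof.
apply/eqP; rewrite eq_le; apply/andP; split.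
  apply/bigmin_geP; split=> [|z]; first exact: leey.
  rewrite inE => zA.
  pose x : 'cV[bool]_n := \col_i (z i 0 && (p i 0 <= q i 0)).
  pose y : 'cV[bool]_n := \col_i (z i 0 && (q i 0 < p i 0)).
  have xyE : realvec R x + realvec R y = realvec R z.
    apply/matrixP => i j; rewrite (ord1 j) !mxE.
    by case: (z i 0); case: leP; rewrite ?addr0 ?add0r.
  apply: (bigmin_inf x) => //; apply: (bigmin_inf y).
    rewrite inE xyE zA; apply/vleP => i; rewrite !mxE.
    by case: (z i 0) => /=; rewrite ?ler01.
  rewrite lee_fin lerD2r /dot -big_split /=; apply: ler_sum => i _.
  by rewrite !mxE; case: (z i 0); case: (leP (p i 0) (q i 0)) => ? /=; lra.
apply: le_bigmin => [|x _]; first exact: leey.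
apply: le_bigmin => [|y]; first exact: leey.
rewrite inE => /andP[xyA /vleP xy1].
pose z : 'cV[bool]_n := \col_i (x i 0 || y i 0).
have zE : realvec R z = realvec R x + realvec R y.
  apply/matrixP => i j; rewrite (ord1 j); have := xy1 i; rewrite !mxE.
  by case: (x i 0) => //=; case: (y i 0) => //=; lra.
apply: (bigmin_inf z); first by rewrite inE zE.
rewrite lee_fin lerD2r /dot -big_split /=; apply: ler_sum => i _.
have := xy1 i; rewrite zE !mxE.
by case: (x i 0); case: (y i 0); case: (leP (p i 0) (q i 0)) => /= ?; lra.
Qed.

Lemma robust_value_decomposition (R : realType) (disc : bool) m n
    (I : instance R m n) :
  valid disc I ->
  robust_value disc I =
    mine (nominal_value (lhs I) (rhs I) (vmin (c_lo I) (d_lo I)) (budget I))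
         (nominal_value (lhs I) (rhs I) (vmin (c_hi I) (d_hi I)) 0).
Proof.
move=> vI; rewrite -!nominal_two_stage -bigmin_split.
apply: eq_bigr => x _; rewrite worst_two_stage_cost // bigmin_split.
by congr mine; apply: eq_bigr => y _; rewrite addr0.
Qed.

(** * Computing the two nominal problems *)

(** Register 2 holds the row number; register 3 holds 0, the column number of
a vector entry. *)
Definition put_min (a b o : nat) : prog :=
  If (RLe (Loc a 2 3) (Loc b 2 3))
     (RSet (Loc o 2 3) (RLoc (Loc a 2 3)))
     (RSet (Loc o 2 3) (RLoc (Loc b 2 3))).

(** Register 1 holds the number of items.  Arrays 2 and 4 are the lower, 3 and
5 the upper bounds of the first- and second-stage costs. *)
Definition min_loop : prog :=
  While (NLt 2 1)
    (Seq (put_min 2 4 7) (Seq (put_min 3 5 9) (NSet 2 (NSucc 2)))).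

(** Array 6 is the budget, the constant of the first problem.  The constant of
the second one is the initial content 0 of array 10. *)
Definition decompose : prog :=
  Seq (RSet (Loc 8 3 3) (RLoc (Loc 6 3 3))) min_loop.

Lemma run_put_min (R : realType) (s : state R) a b o :
  run (put_min a b o) s
    (rset s (Loc o 2 3)
       (Num.min (rget s (Loc a 2 3)) (rget s (Loc b 2 3)))) 2.
Proof.
by apply: run_if; rewrite /teval minEle; case: ifP => _; exact: run_rset.
Qed.

(** The loop is described from an arbitrary row on, with [k] rows to go, so that
the induction on [k] goes through: rows before it keep their contents.  An
iteration costs 2 + 2 steps for the minima, 1 for the counter and 1 for the
test of the loop. *)
Lemma run_min_loop (R : realType) (k : nat) (s : state R) :
  nreg s 3 = 0%N -> nreg s 1 = (nreg s 2 + k)%N ->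
  exists s', [/\ run min_loop s s' (6 * k + 1),
    forall a, a != 7%N -> a != 9%N -> rarr s' a = rarr s a
  & forall j, let z := (nreg s 2 <= j < nreg s 1)%N in
    rarr s' 7 j 0%N = (if z then Num.min (rarr s 2 j 0%N) (rarr s 4 j 0%N)
                       else rarr s 7 j 0%N) /\
    rarr s' 9 j 0%N = (if z then Num.min (rarr s 3 j 0%N) (rarr s 5 j 0%N)
                       else rarr s 9 j 0%N)].
Proof.
elim: k s => [|k IH] s s3 s1.
  exists s; split=> //; first by apply: run_while_false; rewrite /= s1 addn0 ltnn.
  by move=> j /=; rewrite s1 addn0; case: ltnP => // ?; rewrite andbF.
(* The states after each of the three parts of the loop body. *)
pose s2 := rset s (Loc 7 2 3)
  (Num.min (rget s (Loc 2 2 3)) (rget s (Loc 4 2 3))).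
pose s4 := rset s2 (Loc 9 2 3)
  (Num.min (rget s2 (Loc 3 2 3)) (rget s2 (Loc 5 2 3))).
pose s5 := nset s4 2 (nreg s 2).+1.
have [||s' [r' frame val]] := IH s5; rewrite ?/s5 //=; first by rewrite s1; lia.
exists s'; split.
- have -> : (6 * k.+1 + 1 = (2 + (2 + 1) + (6 * k + 1)).+1)%N by lia.
  apply: run_while_true r'; first by rewrite /= s1; lia.
  apply: run_seq; first exact: run_put_min.
  apply: run_seq; first exact: run_put_min.
  exact: run_nset.
- move=> a a7 a9; rewrite frame //=.
  by do 2 (apply: funext => ?); rewrite (negbTE a7) (negbTE a9).
- move=> j; have := val j; rewrite /= s3 => -[-> ->].
  rewrite !andbT; case: (ltngtP (nreg s 2) j) => [lt|gt|<-] //=.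
  by have -> : (nreg s 2 < nreg s 1)%N by lia.
Qed.

Lemma padE (R : realType) m n (A : 'M[R]_(m, n)) (i : 'I_m) (j : 'I_n) :
  pad A i j = A i j.
Proof. by rewrite /pad !valK. Qed.

Theorem theorem14 (R : realType) (discrete : bool) :
  decomposable_into_two_nominal
    (fun (m n : nat) (I : instance R m n) => valid discrete I)
    (fun (m n : nat) (I : instance R m n) => robust_value discrete I).
Proof.
exists decompose, 6%N => m n I vI.
pose s0 := rset (input I) (Loc 8 3 3) (reval (input I) (RLoc (Loc 6 3 3))).
have [//|//|s [rs frame val]] := @run_min_loop R n s0.
exists s, (1 + (6 * n + 1))%N; split.
- by apply: run_seq rs; exact: run_rset.
- (* The time is linear; 6 is the constant factor, and the exponent is the
     same number. *)
  apply: (@leq_trans (6 * input_size m n)%N); first by rewrite /input_size; lia.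
  by rewrite leq_mul2l /= -[leqLHS]expn1 leq_pexp2l // /input_size addn1.
- rewrite robust_value_decomposition //.
  have pad_col (u : 'cV[R]_n) (i : 'I_n) : pad u i 0 = u i 0.
    exact: (padE u i (0 : 'I_1)).
  have -> : out_vec n s 7 = vmin (c_lo I) (d_lo I).
    by apply/matrixP => i j; rewrite !mxE (val i).1 /= ltn_ord !pad_col.
  have -> : out_vec n s 9 = vmin (c_hi I) (d_hi I).
    by apply/matrixP => i j; rewrite !mxE (val i).2 /= ltn_ord !pad_col.
  have -> : out_scalar s 8 = budget I.
    rewrite /out_scalar frame //=.
    by rewrite (padE (budget I)%:M (0 : 'I_1) (0 : 'I_1)) mxE mulr1n.
  by have -> : out_scalar s 10 = 0 by rewrite /out_scalar frame.
Qed.
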